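(* Let $\mathcal{S}$ be an idempotent clone over $E_3=\{0,1,2\}$ such that $\mathcal{S}\not\preceq_{\mathrm m}\mathcal{C}_2$, $\mathcal{S}\not\preceq_{\mathrm m}\mathcal{C}_3$, and $\mathcal{S}\not\preceq_{\mathrm m}\mathcal{B}_2$. Then there is a minor homomorphism from $\mathcal{I}_2$ to $\mathcal{S}$.
   Context: For $k\ge 1$ let $E_k=\{0,\dots,k-1\}$. A clone over $E_k$ is a set of finitary operations $E_k^n\to E_k$ ($n\ge 1$) that contains all projections and is closed under composition. It is idempotent if every operation $f$ in it satisfies $f(x,\dots,x)=x$ for all $x\in E_k$. For an $n$-ary operation $f$ and a map $\sigma\colon E_n\to E_r$, the minor $f_\sigma$ is the $r$-ary operation $f_\sigma(x_0,\dots,x_{r-1})=f(x_{\sigma(0)},\dots,x_{\sigma(n-1)})$. For clones $\mathcal{A},\mathcal{B}$ (possibly over different finite sets), a minor homomorphism from $\mathcal{A}$ to $\mathcal{B}$ is an arity-preserving map $\xi\colon\mathcal{A}\to\mathcal{B}$ with $\xi(f_\sigma)=\xi(f)_\sigma$ for all $n$-ary $f\in\mathcal{A}$ and all $\sigma\colon E_n\to E_r$. We write $\mathcal{A}\preceq_{\mathrm m}\mathcal{B}$ if such a map exists, and $\mathcal{A}\not\preceq_{\mathrm m}\mathcal{B}$ otherwise. $\operatorname{Pol}(A;R_1,\dots,R_m)$ denotes the clone of all operations on $A$ that preserve the relations $R_1,\dots,R_m$ (an operation preserves $R$ if applying it coordinatewise to tuples of $R$ always yields a tuple of $R$). Define $\mathcal{C}_2=\operatorname{Pol}(\{0,1\};\{(0,1),(1,0)\})$,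 $\mathcal{C}_3=\operatorname{Pol}(\{0,1,2\};\{(0,1),(1,2),(2,0)\})$, $\mathcal{B}_2=\operatorname{Pol}(\{0,1\};\{0\},\{1\},\{(0,1),(1,0),(1,1)\})$, and $\mathcal{I}_2=\operatorname{Pol}(\{0,1\};\{0\},\{1\})$, the clone of all idempotent operations on $\{0,1\}$. *)

(* Defs.v *)
From mathcomp Require Import all_boot.

Set Implicit Arguments.
Unset Strict Implicit.
Unset Printing Implicit Defensive.

(* Only positive arities are considered: [op A n] is the type of operations
   of arity n + 1, with arguments indexed by 'I_n.+1. *)
Definition op (A : finType) (n : nat) := {ffun {ffun 'I_n.+1 -> A} -> A}.

Definition proj (A : finType) n (i : 'I_n.+1) : op A n := [ffun x : {ffun 'I_n.+1 -> A} => x i].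

Definition compose (A : finType) n m (f : op A n) (g : 'I_n.+1 -> op A m) :
  op A m := [ffun x => f [ffun i => g i x]].

Definition minor (A : finType) n r (s : 'I_n.+1 -> 'I_r.+1) (f : op A n) :
  op A r := [ffun x : {ffun 'I_r.+1 -> A} => f [ffun i => x (s i)]].

Definition opset (A : finType) := forall n, {set op A n}.

Record clone (A : finType) (C : opset A) : Prop := Clone {
  clone_proj : forall n (i : 'I_n.+1), proj A i \in C n;
  clone_compose : forall n m (f : op A n) (g : 'I_n.+1 -> op A m),
    f \in C n -> (forall i, g i \in C m) -> compose f g \in C m
}.

Definition idempotent_opset (A : finType) (C : opset A) : Prop :=
  forall n (f : op A n), f \in C n -> forall x : A, f [ffun=> x] = x.

(* [xi] is a total function on operations, but only its values on [C] are
   constrained; restricting it to [C] gives a map from [C] to [D]. *)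
Definition minor_hom (A B : finType) (C : opset A) (D : opset B)
    (xi : forall n, op A n -> op B n) : Prop :=
  (forall n (f : op A n), f \in C n -> xi n f \in D n) /\
  (forall n r (f : op A n) (s : 'I_n.+1 -> 'I_r.+1),
     f \in C n -> xi r (minor s f) = minor s (xi n f)).

Definition minor_le (A B : finType) (C : opset A) (D : opset B) : Prop :=
  exists xi : forall n, op A n -> op B n, minor_hom C D xi.

(* Finitary relations on A, bundled with their arity. *)
Definition relation (A : finType) := {s : nat & {set s.-tuple A}}.

Definition mkrel (A : finType) s (R : {set s.-tuple A}) : relation A :=
  Tagged (fun s => {set s.-tuple A}) R.

Definition preserves (A : finType) n (f : op A n) (R : relation A) : bool :=
  [forall t : {ffun 'I_n.+1 -> (tag R).-tuple A},
     [forall i, t i \in tagged R] ==>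
     ([tuple f [ffun i => tnth (t i) j] | j < tag R] \in tagged R)].

Definition Pol (A : finType) (Rs : seq (relation A)) : opset A :=
  fun n => [set f : op A n | all (preserves f) Rs].

Definition b0 : 'I_2 := @Ordinal 2 0 isT.
Definition b1 : 'I_2 := @Ordinal 2 1 isT.
Definition t0 : 'I_3 := @Ordinal 3 0 isT.
Definition t1 : 'I_3 := @Ordinal 3 1 isT.
Definition t2 : 'I_3 := @Ordinal 3 2 isT.

Definition C2 : opset 'I_2 :=
  Pol [:: mkrel [set [tuple b0; b1]; [tuple b1; b0]]].

Definition C3 : opset 'I_3 :=
  Pol [:: mkrel [set [tuple t0; t1]; [tuple t1; t2]; [tuple t2; t0]]].

Definition B2 : opset 'I_2 :=
  Pol [:: mkrel [set [tuple b0]]; mkrel [set [tuple b1]];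
          mkrel [set [tuple b0; b1]; [tuple b1; b0]; [tuple b1; b1]]].

Definition I2 : opset 'I_2 :=
  Pol [:: mkrel [set [tuple b0]]; mkrel [set [tuple b1]]].

(* Main.v *)
Require Import Defs.
From mathcomp Require Import all_boot zify.

Set Implicit Arguments.
Unset Strict Implicit.
Unset Printing Implicit Defensive.

(** The three hypotheses say that S contains three particular operations.
    A map kappa from the operations of arity k to {0, .., k - 1} induces a
    minor-compatible map sending f to the operation x |-> kappa (f_x), where
    f_x is the minor of f along the tuple x.  When no commutative binary
    operation exists in S, swapping the arguments has no fixed point among the
    binary operations of S, so it admits a 2-colouring kappa, and the induced
    map goes into C2.  In the same way S contains a ternary operation c
    invariant under cyclic shifts, or else S maps to C3, and a Mal'cev
    operation q, that is q(x,y,y) = x = q(y,y,x), or else S maps to B2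
    ([commutative_of_not_C2], [cyclic_of_not_C3], [maltsev_of_not_B2]).

    The Mal'cev operation can be improved to a majority operation.  The only
    obstruction is an abelian quotient of a subalgebra; on at most three
    elements this would be an affine Z/2 or Z/3, and b and c rule these out
    ([exists_majority]).  By Baker and Pixley an operation then belongs to S as
    soon as it agrees with members of S on every two arguments, so only binary
    invariant relations matter ([baker_pixley]).

    It remains to choose kappa, now going from the ternary idempotent Boolean
    operations to {0,1,2}, so that the induced operations preserve every binary
    invariant relation R.  Because of q, such an R is a bijection between the
    blocks of a partition of its domain and those of a partition of its range.
    One block gives products of subalgebras, three blocks give automorphisms,
    and two blocks give isomorphisms between two-element quotients of
    subalgebras.  On a two-element quotient b is a semilattice operation, hence
    orients it, and all isomorphisms respect this orientation.  Reading 0 and 1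
    along it, a Boolean operation acts on the quotient, and kappa is right when
    it realizes this action on all two-element quotients at once and commutes
    with automorphisms ([adapted], [adapted_invariant]).

    Two choices of kappa suffice.  If S has a congruence with classes {u,v}
    and {w}, it is the only nontrivial one, since distinct ones do not permute;
    the orientations then fit together to a linear order u < v < w, and kappa
    is read off from the upper sets of that order ([chain_vote]).  Otherwise
    all two-element quotients are two-element subalgebras, and Boolean
    operations depending on all three arguments may go to a constant; a value of
    the symmetric operation b(c(x,y,z), c(y,x,z)) is fixed by all automorphisms
    ([pair_vote]). *)

(** * Minors and induced maps *)

Section Minors.
Variables A : finType.

Lemma minor_minor n m r (s : 'I_n.+1 -> 'I_m.+1) (t : 'I_m.+1 -> 'I_r.+1)
    (f : op A n) : minor t (minor s f) = minor (t \o s) f.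
Proof.
by apply/ffunP=> x; rewrite !ffunE; congr (f _); apply/ffunP=> i; rewrite !ffunE.
Qed.

Lemma eq_minor n r (s t : 'I_n.+1 -> 'I_r.+1) (f : op A n) :
  s =1 t -> minor s f = minor t f.
Proof.
by move=> st; apply/ffunP=> x; rewrite !ffunE; congr (f _); apply/ffunP=> i; rewrite !ffunE st.
Qed.

Lemma minor_id n (f : op A n) : minor id f = f.
Proof.
by apply/ffunP=> x; rewrite !ffunE; congr (f _); apply/ffunP=> i; rewrite !ffunE.
Qed.

Lemma clone_minor (C : opset A) : clone C -> forall n r (s : 'I_n.+1 -> 'I_r.+1) f,
  f \in C n -> minor s f \in C r.
Proof.
move=> hC n r s f fC.
suff -> : minor s f = compose f (fun i => proj A (s i)).
  by apply: clone_compose => // i; apply: clone_proj.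
apply/ffunP=> x; rewrite !ffunE; congr (f _); apply/ffunP=> i.
by rewrite !ffunE.
Qed.

(** For f in a clone, the tuple x names a minor of f; choosing kappa amounts to
    choosing a map out of the free structure generated by that clone. *)
Definition induced k (kappa : op A k -> 'I_k.+1) n (f : op A n) : op 'I_k.+1 n :=
  [ffun x : {ffun 'I_n.+1 -> 'I_k.+1} => kappa (minor x f)].

Lemma induced_minor k (kappa : op A k -> 'I_k.+1) n r
    (s : 'I_n.+1 -> 'I_r.+1) (f : op A n) :
  induced kappa (minor s f) = minor s (induced kappa f).
Proof.
apply/ffunP=> x; rewrite !ffunE minor_minor; congr (kappa _).
by apply: eq_minor => i; rewrite ffunE.
Qed.

Lemma induced_minor_le k (kappa : op A k -> 'I_k.+1) (C : opset A)
    (D : opset 'I_k.+1) :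
  (forall n f, f \in C n -> induced kappa f \in D n) -> minor_le C D.
Proof.
by move=> h; exists (induced kappa); split=> // n r f s _; apply: induced_minor.
Qed.

Lemma preservesP n (f : op A n) k (R : {set k.-tuple A}) :
  reflect (forall t : 'I_n.+1 -> k.-tuple A, (forall i, t i \in R) ->
             [tuple f [ffun i => tnth (t i) j] | j < k] \in R)
          (preserves f (mkrel R)).
Proof.
apply: (iffP forallP) => [h t tR|h t].
  have /implyP := h (finfun t); rewrite /=.
  have -> : [tuple f [ffun i => tnth (t i) j]  | j < k] =
     [tuple f [ffun i => tnth ([ffun i => t i] i) j]  | j < k].
    apply: eq_from_tnth => j; rewrite !tnth_mktuple; congr (f _).
    by apply/ffunP=> i; rewrite !ffunE.
  by apply; apply/forallP=> i; rewrite ffunE.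
by apply/implyP=> /forallP tR; apply: h.
Qed.

Lemma preserves1P n (f : op A n) (a : A) :
  preserves f (mkrel [set [tuple a]]) = (f [ffun=> a] == a).
Proof.
apply/preservesP/eqP => [h|fa t tR].
  have /set1P /(congr1 (fun t => tnth t ord0)) := h (fun=> [tuple a]) (fun i => set11 _).
  rewrite tnth_mktuple => e; apply: etrans e.
  by congr (f _); apply/ffunP=> i; rewrite !ffunE.
apply/set1P/eq_from_tnth => j; rewrite tnth_mktuple ord1.
transitivity (f [ffun=> a]); last exact: fa.
by congr (f _); apply/ffunP=> i; rewrite !ffunE; have /set1P -> := tR i.
Qed.

Lemma preserves2P n (f : op A n) (R : {set 2.-tuple A}) :
  reflect (forall x y : {ffun 'I_n.+1 -> A},
     (forall i, [tuple x i; y i] \in R) -> [tuple f x; f y] \in R)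
  (preserves f (mkrel R)).
Proof.
have eqt (t : 2.-tuple A) : t = [tuple tnth t b0; tnth t b1].
  by apply: eq_from_tnth => -[[|[|//]] i]; rewrite [in RHS](tnth_nth (tnth t b0)) /=;
  congr (tnth t _); apply: val_inj.
apply: (iffP (preservesP f R)) => [h x y xyR|h t tR].
  have := h (fun i => [tuple x i; y i]) xyR.
  rewrite [X in X \in R]eqt !tnth_mktuple.
  by congr ([tuple f _; f _] \in R); apply/ffunP=> i; rewrite ffunE.
rewrite [X in X \in R]eqt !tnth_mktuple; apply: h => i.
by rewrite !ffunE -eqt.
Qed.

End Minors.

(** * Term operations *)

Section TermOperations.
Variables (A : finType) (C : opset A).
Hypothesis hC : clone C.

Definition definable n (g : {ffun 'I_n.+1 -> A} -> A) := finfun g \in C n.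

Definition definable2 (b : A -> A -> A) :=
  definable (fun v : {ffun 'I_2 -> A} => b (v b0) (v b1)).

Definition definable3 (t : A -> A -> A -> A) :=
  definable (fun v : {ffun 'I_3 -> A} => t (v t0) (v t1) (v t2)).

Lemma definable_var n (i : 'I_n.+1) : definable (fun v => v i).
Proof. exact: clone_proj. Qed.

Lemma definable_op n (f : op A n) : f \in C n -> definable f.
Proof. by rewrite /definable (_ : finfun f = f) //; apply/ffunP=> x; rewrite ffunE. Qed.

Lemma definable_comp2 n b (g1 g2 : {ffun 'I_n.+1 -> A} -> A) :
  definable2 b -> definable g1 -> definable g2 ->
  definable (fun v => b (g1 v) (g2 v)).
Proof.
move=> db d1 d2.
have gC (i : 'I_2) : (if i == b0 then finfun g1 else finfun g2) \in C n.
  by case: ifP.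
have := clone_compose hC db gC; set c := compose _ _ => cC.
rewrite /definable; suff <- : c = [ffun v => b (g1 v) (g2 v)] by [].
by apply/ffunP=> v; rewrite /c !ffunE /= ?ffunE.
Qed.

Lemma definable_comp3 n t (g1 g2 g3 : {ffun 'I_n.+1 -> A} -> A) :
  definable3 t -> definable g1 -> definable g2 -> definable g3 ->
  definable (fun v => t (g1 v) (g2 v) (g3 v)).
Proof.
move=> dt d1 d2 d3.
have gC (i : 'I_3) : (if i == t0 then finfun g1 else
    if i == t1 then finfun g2 else finfun g3) \in C n by do 2?case: ifP.
have := clone_compose hC dt gC; set c := compose _ _ => cC.
rewrite /definable; suff <- : c = [ffun v => t (g1 v) (g2 v) (g3 v)] by [].
by apply/ffunP=> v; rewrite /c !ffunE /= ?ffunE.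
Qed.

Definition app2 (f : op A 1) x y := f [ffun i : 'I_2 => if i == b0 then x else y].

Definition app3 (f : op A 2) x y z :=
  f [ffun i : 'I_3 => if i == t0 then x else if i == t1 then y else z].

Lemma definable_app2 f : f \in C 1 -> definable2 (app2 f).
Proof.
move=> fC; rewrite /definable2 /definable (_ : finfun _ = f) //.
apply/ffunP=> v; rewrite ffunE; congr (f _); apply/ffunP=> i; rewrite ffunE.
by case: i => [[|[|//]] i]; congr (v _); apply: val_inj.
Qed.

Lemma definable_app3 f : f \in C 2 -> definable3 (app3 f).
Proof.
move=> fC; rewrite /definable3 /definable (_ : finfun _ = f) //.
apply/ffunP=> v; rewrite ffunE; congr (f _); apply/ffunP=> i; rewrite ffunE.
by case: i => [[|[|[|//]]] i]; congr (v _); apply: val_inj.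
Qed.

End TermOperations.

Definition maltsev (A : Type) (q : A -> A -> A -> A) :=
  (forall x y, q x y y = x) /\ (forall x y, q y y x = x).

(** * Operations forced by the three hypotheses *)

Section Colourings.
Variables (A : finType) (C : opset A).
Hypothesis hC : clone C.

Definition swap2 (i : 'I_2) : 'I_2 := if i == b0 then b1 else b0.
Definition rot3 (i : 'I_3) : 'I_3 := if i == t0 then t1 else if i == t1 then t2 else t0.

Lemma swap2K : involutive swap2.
Proof. by case=> [[|[|//]] i]; apply: val_inj. Qed.

Lemma rot3K i : rot3 (rot3 (rot3 i)) = i.
Proof. by case: i => [[|[|[|//]]] i]; apply: val_inj. Qed.

(** The exchange of arguments is an involution on the binary operations; without
    a fixed point in the clone its orbits are pairs, and comparing ranks in an enumeration
    colours the two members of each pair differently. *)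
Lemma commutative_of_not_C2 : ~ minor_le C C2 ->
  exists2 b, definable2 C b & forall x y, b x y = b y x.
Proof.
move=> hn.
case: (pickP [pred f in C 1 | minor swap2 f == f]) => [f /andP[fC /eqP fE]|no].
  exists (app2 f) => [|x y]; first exact: definable_app2.
  rewrite -{1}fE /app2 ffunE; congr (f _); apply/ffunP=> i; rewrite !ffunE.
  by case: i => [[|[|//]] i].
case: hn.
pose kappa (f : op A 1) := if enum_rank f < enum_rank (minor swap2 f) then b0 else b1.
have kE f : f \in C 1 -> kappa (minor swap2 f) = swap2 (kappa f).
  move=> fC; rewrite /kappa minor_minor.
  rewrite (eq_minor _ (swap2K : swap2 \o swap2 =1 id)) minor_id.
  have := no f; rewrite /= fC => /negbT ne.
  by case: ltngtP => // /ord_inj/enum_rank_inj e; case/eqP: ne.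
apply: (induced_minor_le (kappa := kappa)) => n f fC.
rewrite inE /= andbT; apply/preserves2P => x y xyR; rewrite !ffunE.
have -> : minor y f = minor swap2 (minor x f).
  rewrite minor_minor; apply: eq_minor => i /=.
  have := xyR i; rewrite !inE => /orP[] /eqP/(congr1 val) [-> ->];
  exact: val_inj.
rewrite kE; last exact: clone_minor.
by case: (kappa _) => [[|[|//]] i]; rewrite !inE; apply/orP; [left|right];
  apply/eqP; apply: val_inj => /=; congr [:: _; _]; apply: val_inj.
Qed.

(** The cyclic shift has order three, so without a fixed point in the clone all
    its orbits there have three members.  Colour a member by its position relative to the member of
    least rank. *)
Lemma cyclic_of_not_C3 : ~ minor_le C C3 ->
  exists2 c, definable3 C c & forall x y z, c x y z = c y z x.
Proof.
move=> hn.
case: (pickP [pred f in C 2 | minor rot3 f == f]) => [f /andP[fC /eqP fE]|no].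
  exists (app3 f) => [|x y z]; first exact: definable_app3.
  rewrite -{1}fE /app3 ffunE; congr (f _); apply/ffunP=> i; rewrite !ffunE.
  by case: i => [[|[|[|//]]] i].
case: hn.
pose r (f : op A 2) := minor rot3 f.
have r3 f : r (r (r f)) = f.
  by rewrite /r !minor_minor -[RHS]minor_id; apply: eq_minor; apply: rot3K.
pose least (f : op A 2) :=
  (enum_rank f < enum_rank (r f)) && (enum_rank f < enum_rank (r (r f))).
pose kappa (f : op A 2) := if least f then t0 else if least (r (r f)) then t1 else t2.
have kE f : f \in C 2 -> kappa (r f) = rot3 (kappa f).
  move=> fC; rewrite /kappa /least !r3.
  have := no f; rewrite /= fC -/(r f) => /negbT ne.
  have ne1 : enum_rank f != enum_rank (r f) :> nat.
    by apply/eqP => /ord_inj/enum_rank_inj e; case/eqP: ne.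
  have ne2 : enum_rank f != enum_rank (r (r f)) :> nat.
    apply/eqP => /ord_inj/enum_rank_inj e; case/eqP: ne.
    by rewrite -{2}(r3 f) -e.
  have ne3 : enum_rank (r f) != enum_rank (r (r f)) :> nat.
    apply/eqP => /ord_inj/enum_rank_inj e; case/eqP: ne.
    by rewrite -{2}(r3 f) -!e.
  move: ne1 ne2 ne3; move: (nat_of_ord _) (nat_of_ord _) (nat_of_ord _) => i j k.
  move=> ne1 ne2 ne3; case: (ltngtP i j) => ij; case: (ltngtP i k) => ik;
  case: (ltngtP j k) => jk; first [exact: val_inj | exfalso; clear -ij ik jk ne1 ne2 ne3; lia].
apply: (induced_minor_le (kappa := kappa)) => n f fC.
rewrite inE /= andbT; apply/preserves2P => x y xyR; rewrite !ffunE.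
have -> : minor y f = r (minor x f).
  rewrite /r minor_minor; apply: eq_minor => i /=.
  have := xyR i; rewrite !inE => /orP[/orP[]|] /eqP/(congr1 val) [-> ->];
  exact: val_inj.
rewrite kE; last exact: clone_minor.
case: (kappa _) => [[|[|[|//]]] i]; rewrite !inE; apply/orP;
 [left; apply/orP; left|left; apply/orP; right|right];
  by apply/eqP; apply: val_inj => /=; congr [:: _; _]; apply: val_inj.
Qed.

(** Colour the first projection 0 and all other binary operations 1.  The only way
    for the induced map to violate the relation {01, 10, 11} is an operation
    whose minors t(x,y,y) and t(y,x,y) both are the first projection, and
    exchanging its last two arguments makes it Mal'cev. *)
Lemma maltsev_of_not_B2 : (exists a0 a1 : A, a0 != a1) -> idempotent_opset C ->
  ~ minor_le C B2 -> exists2 q, definable3 C q & maltsev q.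
Proof.
move=> [a0 [a1 a01]] hI hn.
pose al (i : 'I_3) := if i == t0 then b0 else b1.
pose be (i : 'I_3) := if i == t1 then b0 else b1.
case: (pickP [pred f in C 2 | (minor al f == proj A b0) && (minor be f == proj A b0)])
  => [f /and3P[fC /eqP/ffunP fal /eqP/ffunP fbe]|no].
  have df := definable_app3 fC.
  exists (fun x y z => app3 f x z y).
    by apply: (definable_comp3 hC df); apply: definable_var.
  split=> x y.
    have := fal [ffun i => if i == b0 then x else y]; rewrite !ffunE /= => e.
    apply: etrans e; congr (f _); apply/ffunP=> i; rewrite !ffunE /al.
    by case: i => [[|[|[|//]]] i].
  have := fbe [ffun i => if i == b0 then x else y]; rewrite !ffunE /= => e.
  apply: etrans e; congr (f _); apply/ffunP=> i; rewrite !ffunE /be.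
  by case: i => [[|[|[|//]]] i].
case: hn.
pose kappa (f : op A 1) := if f == proj A b0 then b0 else b1.
apply: (induced_minor_le (kappa := kappa)) => n f fC.
rewrite inE /= andbT !preserves1P; apply/and3P; split.
- rewrite ffunE /kappa ifT //; apply/eqP/ffunP => x; rewrite !ffunE.
  rewrite -[RHS](hI _ _ fC); congr (f _); apply/ffunP=> i; by rewrite !ffunE.
- rewrite ffunE /kappa ifF //; apply/eqP => /ffunP /(_ [ffun i => if i == b0 then a0 else a1]).
  rewrite !ffunE /= => e; case/eqP: a01; rewrite -{}e -[RHS](hI _ _ fC); congr (f _).
  by apply/ffunP=> i; rewrite !ffunE.
apply/preserves2P => x y xyR; rewrite !ffunE.
(* The three tuples 01, 10, 11 of the relation index the arguments of a ternary minor. *)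
pose code (i : 'I_n.+1) := if x i == b0 then t0 else if y i == b0 then t1 else t2.
have xE : minor x f = minor al (minor code f).
  rewrite minor_minor; apply: eq_minor => i /=.
  have := xyR i; rewrite /code !inE => /orP[/orP[]|] /eqP/(congr1 val) [-> ->];
  exact: val_inj.
have yE : minor y f = minor be (minor code f).
  rewrite minor_minor; apply: eq_minor => i /=.
  have := xyR i; rewrite /code !inE => /orP[/orP[]|] /eqP/(congr1 val) [-> ->];
  exact: val_inj.
have := no (minor code f); rewrite /= clone_minor //= -xE -yE /kappa.
case: eqP => _; case: eqP => _ // _; rewrite !inE; apply/orP;
  [left; apply/orP; left|left; apply/orP; right|right]; exact/eqP.
Qed.

End Colourings.

(** * Majority and interpolation on two arguments *)

Section BakerPixley.
Variables (A : finType) (C : opset A).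
Hypothesis hC : clone C.

(** Interpolation extends from two points to any finite set: of interpolants that
    each miss one of three given points, at least two are right at every point. *)
Lemma baker_pixley m n (g : op A n) :
  definable3 C m ->
  (forall x y, [/\ m x x y = x, m x y x = x & m y x x = x]) ->
  (forall s t, exists f, [/\ f \in C n, f s = g s & f t = g t]) -> g \in C n.
Proof.
move=> dm maj loc.
suff all_pts k (l : seq {ffun 'I_n.+1 -> A}) : size l <= k ->
    exists2 f, f \in C n & {in l, f =1 g}.
  have [f fC fg] := all_pts _ (enum {ffun 'I_n.+1 -> A}) (leqnn _).
  by rewrite (_ : g = f) //; apply/ffunP=> v; rewrite fg // mem_enum.
elim: k l => [|k IH] [|s [|t [|u l]]] //= sz.
- by exists (proj A ord0) => //; apply: clone_proj.
- by exists (proj A ord0) => //; apply: clone_proj.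
- have [f [fC fs _]] := loc s s; exists f => // v; by rewrite inE => /eqP ->.
- have [f [fC fs ft]] := loc s t; exists f => // v; by rewrite !inE => /orP[] /eqP ->.
have [f1 d1 e1] := IH (t :: u :: l) sz.
have [f2 d2 e2] := IH (s :: u :: l) sz.
have [f3 d3 e3] := IH (s :: t :: l) sz.
exists (finfun (fun v => m (f1 v) (f2 v) (f3 v))).
  by apply: (definable_comp3 hC dm); exact: definable_op.
move=> v; rewrite ffunE !inE => /or4P[/eqP->|/eqP->|/eqP->|vl].
- by rewrite e2 ?e3 ?inE ?eqxx //; have [_ _ ->] := maj (g s) (f1 s).
- by rewrite e1 ?e3 ?inE ?eqxx ?orbT //; have [_ -> _] := maj (g t) (f2 t).
- by rewrite e1 ?e2 ?inE ?eqxx ?orbT //; have [-> _ _] := maj (g u) (f3 u).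
by rewrite e1 ?e2 ?inE ?vl ?orbT //; have [-> _ _] := maj (g v) (f3 v).
Qed.

End BakerPixley.

Local Notation E3 := 'I_3.

Lemma third_element (a b : 'I_3) : a != b ->
  exists c, [/\ c != a, c != b & forall x, [\/ x = a, x = b | x = c]].
Proof.
move=> ab.
case: a b ab => [[|[|[|//]]] i] [[|[|[|//]]] j] // _;
  [exists t2|exists t1|exists t2|exists t0|exists t1|exists t0]; split=> //;
  case=> [[|[|[|//]]] k];
  by [apply: Or31; apply: val_inj | apply: Or32; apply: val_inj | apply: Or33; apply: val_inj].
Qed.

(** * From Mal'cev to majority *)

Section Pixley.
Variables (C : opset 'I_3) (hC : clone C) (hI : idempotent_opset C).

Lemma definable3_idem (t : E3 -> E3 -> E3 -> E3) : definable3 C t -> forall x, t x x x = x.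
Proof. by move=> /hI h x; have := h x; rewrite !ffunE. Qed.

Lemma definable2_idem (t : E3 -> E3 -> E3) : definable2 C t -> forall x, t x x = x.
Proof. by move=> /hI h x; have := h x; rewrite !ffunE. Qed.

Variables (o : E3 -> E3 -> E3) (c3 q : E3 -> E3 -> E3 -> E3).
Hypotheses (ho : definable2 C o) (hc : definable3 C c3) (hq : definable3 C q).
Hypotheses (oC : forall x y, o x y = o y x) (cC : forall x y z, c3 x y z = c3 y z x).
Hypothesis mq : maltsev q.

Let q_r := mq.1.
Let q_l := mq.2.

Ltac prove_definable := rewrite /definable3;
  repeat (first [exact: definable_var | apply: (definable_comp3 hC hq)
    | apply: (definable_comp3 hC hc) | apply: (definable_comp2 hC ho)]).

Section Pair.
Variables a b : E3.
Hypothesis ab : a != b.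

(** Two ternary term operations that agree on all (x,y,y) and (y,y,x) are
    interchangeable as far as the Mal'cev identities go.  The values of such
    operations at (a,b,a) form the pairs of a congruence on the subalgebra
    generated by a and b, which is the obstruction to making a Mal'cev
    operation return a at (a,b,a): the quotient by it is abelian. *)
Definition linked s t := exists u w, [/\ definable3 C u, definable3 C w,
  (forall x y, u x y y = w x y y) /\ (forall x y, u y y x = w y y x),
  u a b a = s & w a b a = t].

Definition pixley_at := exists r, [/\ definable3 C r, maltsev r & r a b a = a].

Lemma linked_sym s t : linked s t -> linked t s.
Proof.
move=> [u [w [du dw [l1 l2] <- <-]]].
by exists w, u; split=> //; split=> *; rewrite ?l1 ?l2.
Qed.

Lemma linked_refl u : definable3 C u -> linked (u a b a) (u a b a).
Proof. by move=> du; exists u, u. Qed.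

Lemma linked_maltsev s1 t1 s2 t2 s3 t3 : linked s1 t1 -> linked s2 t2 -> linked s3 t3 ->
  linked (q s1 s2 s3) (q t1 t2 t3).
Proof.
move=> [u1 [w1 [du1 dw1 [k1 l1] <- <-]]] [u2 [w2 [du2 dw2 [k2 l2] <- <-]]]
  [u3 [w3 [du3 dw3 [k3 l3] <- <-]]].
exists (fun x y z => q (u1 x y z) (u2 x y z) (u3 x y z)).
exists (fun x y z => q (w1 x y z) (w2 x y z) (w3 x y z)).
split=> //; [exact: (definable_comp3 hC hq)|exact: (definable_comp3 hC hq)|].
by split=> x y; rewrite ?k1 ?k2 ?k3 ?l1 ?l2 ?l3.
Qed.

Lemma linked_trans s t r : linked s t -> linked t r -> linked s r.
Proof.
move=> st tr; have tt : linked t t by have [u [w [_ dw _ _ <-]]] := st; apply: linked_refl.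
by have := linked_maltsev st tt tr; rewrite q_r q_l.
Qed.

(** Modulo the congruence, a term operation is determined by its values at (a,b,b)
    and (b,b,a), and these are combined by x + y = q(x,b,y), which becomes an
    abelian group operation with zero b. *)
Lemma linked_sum u : definable3 C u -> linked (u a b a) (q (u a b b) b (u b b a)).
Proof.
move=> du; exists u, (fun x y z => q (u x y y) y (u y y z)); split=> //.
  apply: (definable_comp3 hC hq); [apply: (definable_comp3 hC du)| |
    apply: (definable_comp3 hC du)]; exact: definable_var.
by split=> x y; rewrite (definable3_idem du) ?q_r ?q_l.
Qed.

(** The operation below agrees with q on the Mal'cev arguments, where u = w, and its
    value at (a,b,a) is q(a, q(a,b,a), q(a,b,a)) = a. *)
Lemma pixley_of_linked : linked a b -> pixley_at.
Proof.
move=> [u [w [du dw [k l] ua wb]]].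
exists (fun x y z => q (u x y z) (q (u x y z) (w x y z) (u x y z)) (q x y z)); split.
- apply: (definable_comp3 hC hq) => //; apply: (definable_comp3 hC hq) => //.
- by split=> x y; rewrite ?k ?l ?q_r q_l ?q_r ?q_l.
- by rewrite ua wb q_r.
Qed.

Lemma pixley_of_linked_value : linked a (q a b a) -> pixley_at.
Proof.
move=> [u [w [du dw [k l] ua wb]]].
exists (fun x y z => q (u x y z) (w x y z) (q x y z)); split.
- exact: (definable_comp3 hC hq).
- by split=> x y; rewrite ?k ?l ?q_l ?q_r.
- by rewrite ua wb q_r.
Qed.

(** Applied to o(x,z), [linked_sum] links a to o(a,b) + o(a,b).  If o(a,b) is a or
    b, this link suffices: commutativity of o excludes Z/2.  If o(a,b) is the third
    element c, it suffices unless c + c = a.  In that case, if no link is nontrivial,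
    + is a group operation, necessarily that of Z/3, and c3 excludes it: c3 has one
    value e at (a,b,b), (b,a,b) and (b,b,a), so that a = c3(a,a,a) = e + e + e = b. *)
Lemma pixley_pair : pixley_at.
Proof.
have [c [ca cb cov]] := third_element ab.
have aa : linked a a by apply: (linked_refl (u := fun x y z => x)); apply: definable_var.
have bb : linked b b by apply: (linked_refl (u := fun x y z => y)); apply: definable_var.
have := @linked_sum (fun x y z => o x z).
rewrite (definable2_idem ho) (oC b a) => /(_ _)/(@id _) h.
have {h} ac : linked a (q (o a b) b (o a b)).
  by apply: h; apply: (definable_comp2 hC) => //; apply: definable_var.
case: (cov (o a b)) => ob; rewrite ob in ac.
- exact: pixley_of_linked_value.
- by apply: pixley_of_linked; rewrite q_r in ac.
case: (cov (q c b c)) => cc; rewrite cc in ac; last first.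
- case: (cov (q a b a)) => qa.
  + by exists q.
  + apply: pixley_of_linked; have := linked_maltsev ac bb ac; rewrite qa cc => /linked_sym.
    exact: linked_trans.
  + by apply: pixley_of_linked_value; rewrite qa.
- exact: pixley_of_linked.
(* Now c + c = a, and a nontrivial link is sufficient, or its sum with itself is. *)
have nontriv s t : linked s t -> s != t -> pixley_at.
  have Lab : linked a b -> pixley_at := pixley_of_linked.
  have Lac : linked a c -> pixley_at.
    move=> h; apply: pixley_of_linked_value; apply: linked_sym.
    by have := linked_maltsev h bb h; rewrite cc.
  have Lbc : linked b c -> pixley_at.
    move=> h; apply: pixley_of_linked; apply: linked_sym.
    by have := linked_maltsev h bb h; rewrite cc q_r.
  move=> h; have h' := linked_sym h.
  by case: (cov s) h h' => ->; case: (cov t) => ->; rewrite ?eqxx //; auto.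
have sum u : definable3 C u -> u a b a = q (u a b b) b (u b b a) \/ pixley_at.
  move=> /linked_sum h; case: (eqVneq (u a b a) (q (u a b b) b (u b b a))); first by left.
  by right; apply: nontriv h _.
have bo := definable2_idem ho b.
(* e1 and e2 are the instances c + (c + a) = (c + c) + a and (a + c) + c = a + (c + c)
   of associativity, e3 and e4 compute c3(a,b,a) and c3(a,a,a). *)
have [|e1|//] := sum (fun x y z => q (o x y) y (q (o x y) y z)); first by prove_definable.
have [|e2|//] := sum (fun x y z => q (q x y (o z y)) y (o z y)); first by prove_definable.
have [e3|//] := sum c3 hc.
have [|e4|//] := sum (fun x y z => c3 x x z); first by prove_definable.
rewrite ob bo !q_l q_r cc in e1.
rewrite ob bo !q_r q_l cc in e2.
rewrite (cC a b b) in e3.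
rewrite (definable3_idem hc) -(cC b a a) -(cC a b a) e3 in e4.
have [ba bc ac'] : [/\ b != a, b != c & a != c] by rewrite (eq_sym b a) (eq_sym b c) (eq_sym a c).
case: (cov (q a b a)) => qa; rewrite qa in e1 e2; first by exists q.
  exfalso; case: (cov (q c b a)) => qc; rewrite qc ?q_r ?cc in e1.
  - by rewrite qc in e1; case/eqP: ab.
  - by case/eqP: bc.
  - by case/eqP: ab.
(* Here a + a = c, and the addition table is that of Z/3. *)
have qcb : q c b a = b.
  case: (cov (q c b a)) => qc; rewrite qc ?cc in e1 => //; last by case/eqP: ac'.
  by rewrite qc in e1; case/eqP: ac'.
have qbc : q a b c = b.
  case: (cov (q a b c)) => qc; rewrite qc ?cc in e2 => //; last by case/eqP: ac'.
  by rewrite qc in e2; case/eqP: ac'.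
exfalso; move/eqP: ab; apply.
by case: (cov (c3 b b a)) e4 => ->; rewrite ?qa ?q_r ?cc ?qcb ?qbc.
Qed.
End Pair.

(** Composing r |-> q(x, r, z) twice with Mal'cev operations preserves the Mal'cev
    identities, whereas doing it once turns the value x at (x,y,y) into y; hence q
    is inserted between r and t.  Pairs already repaired stay repaired, since all
    these operations fix a at (a,a,a). *)
Lemma pixley_pairs (l : seq (E3 * E3)) :
  exists r, [/\ definable3 C r, maltsev r &
    forall a b, (a, b) \in l -> r a b a = a].
Proof.
elim: l => [|[a b] l [r [hr mr rl]]]; first by exists q.
have [t [ht mt tE]] : exists t, [/\ definable3 C t, maltsev t &
    t a (q a (r a b a) a) a = a].
  case: (eqVneq a (q a (r a b a) a)) => [<-|]; last exact: pixley_pair.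
  by exists q; split; rewrite ?q_r.
exists (fun x y z => t x (q x (r x y z) z) z); split.
- apply: (definable_comp3 hC ht); [|apply: (definable_comp3 hC hq) => //|]; exact: definable_var.
- by split=> x y; rewrite ?mr.1 ?mr.2 ?q_r ?q_l ?mt.1 ?mt.2.
- move=> a' b'; rewrite inE => /orP[/eqP[-> ->] //|/rl ->].
  by rewrite q_r mt.1.
Qed.

Lemma exists_majority : exists2 m, definable3 C m &
  forall x y, [/\ m x x y = x, m x y x = x & m y x x = x].
Proof.
have [r [hr mr rl]] := pixley_pairs (enum {: E3 * E3}).
exists (fun x y z => r x (r x y z) z).
  by apply: (definable_comp3 hC hr) => //; apply: definable_var.
move=> x y; have rE a b : r a b a = a by apply: rl; rewrite mem_enum.
by split; rewrite ?mr.2 ?mr.1 ?rE ?mr.1 ?mr.2.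
Qed.

End Pixley.

(** * Boolean operations as systems of winning coalitions *)

(** A ternary Boolean operation is viewed as the family of sets of arguments whose
    indicator it accepts; this makes it an election among the three elements. *)
Definition wins (F : op 'I_2 2) (Q : {set E3}) :=
  F [ffun i => if i \in Q then b1 else b0] == b1.

Definition lives (F : op 'I_2 2) (B : {set E3}) := [forall Q, wins F Q == wins F (Q :&: B)].

Lemma livesP F (B : {set E3}) :
  reflect (forall Q Q' : {set E3}, {in B, Q =i Q'} -> wins F Q = wins F Q') (lives F B).
Proof.
apply: (iffP forallP) => [h Q Q' e|h Q].
  rewrite (eqP (h Q)) (eqP (h Q')); congr wins; apply/setP=> x.
  by rewrite !inE; case: (boolP (x \in B)) => [/e ->|_]; rewrite ?andbF.
by apply/eqP/h => x xB; rewrite !inE xB andbT.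
Qed.

Lemma lives_sub F (B B' : {set E3}) : B \subset B' -> lives F B -> lives F B'.
Proof. by move=> /subsetP sB /livesP h; apply/livesP=> Q Q' e; apply: h => x /sB; apply: e. Qed.

Lemma livesI F (B B' : {set E3}) : lives F B -> lives F B' -> lives F (B :&: B').
Proof.
move=> /livesP h /livesP h'; apply/livesP=> Q Q' e.
rewrite (h Q ((Q :&: B) :|: (Q' :\: B))); last first.
  by move=> x xB; rewrite !inE xB andbT andFb orbF.
apply: h' => x xB'; rewrite !inE; case: (boolP (x \in B)) => xB /=; last by rewrite andbF.
by rewrite andbT orbF; apply: e; rewrite inE xB.
Qed.

Section Voting.
Variable F : op 'I_2 2.
Hypothesis FI : F \in I2 2.

Lemma wins_set0 : wins F set0 = false.
Proof.
move: FI; rewrite inE /= !preserves1P => /and3P[/eqP F0 _ _].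
rewrite /wins (_ : finfun _ = [ffun=> b0]) ?F0 //.
by apply/ffunP=> i; rewrite !ffunE inE.
Qed.

Lemma wins_setT : wins F setT.
Proof.
move: FI; rewrite inE /= !preserves1P => /and3P[_ /eqP F1 _].
rewrite /wins (_ : finfun _ = [ffun=> b1]) ?F1 //.
by apply/ffunP=> i; rewrite !ffunE inE.
Qed.

Lemma lives_wins (B : {set E3}) : lives F B -> wins F B.
Proof. by move=> /livesP h; rewrite (h B setT) ?wins_setT // => x xB; rewrite !inE. Qed.

Lemma lives_lose (B Q : {set E3}) : lives F B -> [disjoint Q & B] -> wins F Q = false.
Proof.
move=> /livesP h d; rewrite (h Q set0) ?wins_set0 // => x xB.
by rewrite inE; apply: contraTF d => xQ; apply/pred0Pn; exists x; rewrite /= xQ.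
Qed.

Lemma lives_set0 : lives F set0 = false.
Proof. by apply/negP=> /lives_wins; rewrite wins_set0. Qed.
End Voting.

Definition dom (R : rel E3) := [set x | [exists y, R x y]].
Definition ran (R : rel E3) := [set y | [exists x, R x y]].

(** What is common to the minors of one Boolean operation along two tuples whose
    entries are pairwise related by R. *)
Definition agree (R : rel E3) F1 F2 := [/\ lives F1 (dom R), lives F2 (ran R) &
  forall Q1 Q2 : {set E3}, (forall x y, R x y -> (x \in Q1) = (y \in Q2)) ->
    wins F1 Q1 = wins F2 Q2].

Lemma wins_minor n (f : op 'I_2 n) (x : {ffun 'I_n.+1 -> E3}) Q :
  wins (minor x f) Q = (f [ffun i => if x i \in Q then b1 else b0] == b1).
Proof. by rewrite /wins ffunE; congr (f _ == _); apply/ffunP=> i; rewrite !ffunE. Qed.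

Lemma agree_minor n (f : op 'I_2 n) (x y : {ffun 'I_n.+1 -> E3}) (R : rel E3) :
  (forall i, R (x i) (y i)) -> agree R (minor x f) (minor y f).
Proof.
move=> xyR; split.
- apply/livesP=> Q Q' e; rewrite !wins_minor; congr (f _ == _); apply/ffunP=> i.
  by rewrite !ffunE e // inE; apply/existsP; exists (y i).
- apply/livesP=> Q Q' e; rewrite !wins_minor; congr (f _ == _); apply/ffunP=> i.
  by rewrite !ffunE e // inE; apply/existsP; exists (x i).
- move=> Q1 Q2 e; rewrite !wins_minor; congr (f _ == _); apply/ffunP=> i.
  by rewrite !ffunE (e _ _ (xyR i)).
Qed.

Definition preserves_op2 (o : E3 -> E3 -> E3) (R : rel E3) :=
  forall x x' y y', R x x' -> R y y' -> R (o x y) (o x' y').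
Definition preserves_op3 (t : E3 -> E3 -> E3 -> E3) (R : rel E3) :=
  forall x x' y y' z z', R x x' -> R y y' -> R z z' -> R (t x y z) (t x' y' z').

(** * Binary invariant relations *)

Section Invariant.
Variables (b : E3 -> E3 -> E3) (p s : E3 -> E3 -> E3 -> E3).

Definition invariant (R : rel E3) :=
  [/\ preserves_op2 b R, preserves_op3 p R & preserves_op3 s R].

Definition compose_rel (R T : rel E3) : rel E3 := fun x y => [exists z, R x z && T z y].

Lemma compose_relP (R T : rel E3) x y : reflect (exists2 z, R x z & T z y) (compose_rel R T x y).
Proof. by apply: (iffP existsP) => [[z /andP[]]|[z ? ?]]; exists z => //; apply/andP; split. Qed.

Definition inverse_rel (R : rel E3) : rel E3 := fun x y => R y x.

Lemma invariant_compose R T : invariant R -> invariant T -> invariant (compose_rel R T).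
Proof.
move=> [Rb Rp Rs] [Tb Tp Ts]; split.
- move=> x x' y y' /compose_relP[u xu ux] /compose_relP[v yv vy].
  by apply/compose_relP; exists (b u v); [apply: Rb|apply: Tb].
- move=> x x' y y' z z' /compose_relP[u xu ux] /compose_relP[v yv vy] /compose_relP[w zw wz].
  by apply/compose_relP; exists (p u v w); [apply: Rp|apply: Tp].
- move=> x x' y y' z z' /compose_relP[u xu ux] /compose_relP[v yv vy] /compose_relP[w zw wz].
  by apply/compose_relP; exists (s u v w); [apply: Rs|apply: Ts].
Qed.

Lemma invariant_inverse R : invariant R -> invariant (inverse_rel R).
Proof.
move=> [Rb Rp Rs]; split.
- by move=> x x' y y'; apply: Rb.
- by move=> x x' y y' z z'; apply: Rp.
- by move=> x x' y y' z z'; apply: Rs.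
Qed.

Hypothesis mp : maltsev p.
Hypothesis bC : forall x y, b x y = b y x.

Lemma rectangular R : invariant R -> forall x y x' y', R x y -> R x' y -> R x' y' -> R x y'.
Proof.
move=> [_ Rp _] x y x' y' xy x'y x'y'.
by have := Rp _ _ _ _ _ _ xy x'y x'y'; rewrite mp.1 mp.2.
Qed.

Definition blocks (P Q : {set E3}) : rel E3 :=
  fun x y => (x \in P) && (y \in P) || (x \in Q) && (y \in Q).

(** The conditions treat the relations with one, two and three blocks.  For two
    blocks P and Q the pair is a two-element quotient oriented by b so that P is
    the lower element, and h has to elect Q exactly when Q wins. *)
Record adapted (h : op 'I_2 2 -> E3) : Prop := Adapted {
  adapted_sub : forall F (B : {set E3}), F \in I2 2 -> {in B &, forall x y, b x y \in B} ->
    lives F B -> h F \in B;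
  adapted_section : forall F (P Q : {set E3}) (K : rel E3), F \in I2 2 ->
    [disjoint P & Q] -> P != set0 -> Q != set0 ->
    invariant K -> K =2 blocks P Q -> {in P & Q, forall x y, b x y \in P} ->
    lives F (P :|: Q) -> (h F \in Q) = wins F Q;
  adapted_aut : forall (sigma : E3 -> E3) (R : rel E3) F G, F \in I2 2 -> G \in I2 2 ->
    injective sigma -> (forall x y, R x y = (y == sigma x)) -> invariant R ->
    agree R F G -> h G = sigma (h F) }.

(** The two blocks of the domain and those of the range are the classes of the
    kernels of R and of its inverse, hence invariant; b orients both pairs alike
    because it preserves R. *)
Lemma adapted_blocks h R F G (P Q P' Q' : {set E3}) x0 x1 y0 y1 :
  adapted h -> invariant R -> F \in I2 2 -> G \in I2 2 -> agree R F G ->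
  (forall x y, R x y = (x \in P) && (y \in P') || (x \in Q) && (y \in Q')) ->
  [disjoint P & Q] -> [disjoint P' & Q'] ->
  x0 \in P -> x1 \in Q -> y0 \in P' -> y1 \in Q' -> b x0 x1 \in P ->
  (h F \in Q) = (h G \in Q').
Proof.
move=> [_ hsec _] iR FI GI [lF lG w] RE dPQ dPQ' x0P x1Q y0P' y1Q' bP.
have nQ x : x \in P -> x \in Q = false by apply: disjointFr.
have nP x : x \in Q -> x \in P = false by apply: disjointFl.
have nQ' x : x \in P' -> x \in Q' = false by apply: disjointFr.
have nP' x : x \in Q' -> x \in P' = false by apply: disjointFl.
have [Rb _ _] := iR.
have closed x x' y y' : x \in P -> x' \in Q -> y \in P' -> y' \in Q' ->
    R (b x x') (b y y').
  by move=> xP xQ yP yQ; apply: Rb; rewrite RE ?xP ?yP ?xQ ?yQ ?orbT.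
have by0 : b y0 y1 \in P'.
  have := closed _ _ _ _ x0P x1Q y0P' y1Q'; rewrite RE bP nQ //= orbF //.
have bPQ : {in P & Q, forall x y, b x y \in P}.
  move=> x y xP yQ; have := closed _ _ _ _ xP yQ y0P' y1Q'.
  by rewrite RE by0 nQ' // andbF orbF andbT.
have bPQ' : {in P' & Q', forall x y, b x y \in P'}.
  move=> x y xP yQ; have := closed _ _ _ _ x0P x1Q xP yQ.
  by rewrite RE bP nQ // orbF.
have RF : (h F \in Q) = wins F Q.
  apply: (hsec _ P _ (compose_rel R (inverse_rel R))) => //.
  - by apply/set0Pn; exists x0.
  - by apply/set0Pn; exists x1.
  - by apply: invariant_compose => //; apply: invariant_inverse.
  - move=> x y; apply/compose_relP/orP => [[z]|[]/andP[xP yP]].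
    + rewrite /inverse_rel !RE => /orP[]/andP[-> zP]; rewrite zP.
        by rewrite nQ' // andbT andbF orbF => ->; left.
      by rewrite nP' // andbT andbF /= => ->; right.
    + by exists y0; rewrite /inverse_rel RE ?xP ?yP y0P'.
    + by exists y1; rewrite /inverse_rel RE ?xP ?yP y1Q' orbT.
  - apply: lives_sub lF; apply/subsetP=> x; rewrite !inE => /existsP[y].
    by rewrite RE => /orP[] /andP[-> _]; rewrite ?orbT.
have RG : (h G \in Q') = wins G Q'.
  apply: (hsec _ P' _ (compose_rel (inverse_rel R) R)) => //.
  - by apply/set0Pn; exists y0.
  - by apply/set0Pn; exists y1.
  - by apply: invariant_compose => //; apply: invariant_inverse.
  - move=> x y; apply/compose_relP/orP => [[z]|[]/andP[xP yP]].
    + rewrite /inverse_rel !RE => /orP[]/andP[zP ->]; rewrite zP.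
        by rewrite nQ //= orbF => ->; left.
      by rewrite nP //= => ->; right.
    + by exists x0; rewrite /inverse_rel RE ?xP ?yP x0P.
    + by exists x1; rewrite /inverse_rel RE ?xP ?yP x1Q orbT.
  - apply: lives_sub lG; apply/subsetP=> y; rewrite !inE => /existsP[x].
    by rewrite RE => /orP[] /andP[_ ->]; rewrite ?orbT.
rewrite RF RG; apply: w => x y; rewrite RE => /orP[] /andP[xP yP].
  by rewrite nQ ?nQ'.
by rewrite xP yP.
Qed.

(** Suppose R misses (x, y), where x and y are the elected elements.  These lie in
    the domain and in the range, so x is related to some y' and some x' to y, and
    by rectangularity R has at least two blocks: those of x and of x'.  If there is
    no third one, the two-block case applies, with the orientation given by b.
    Otherwise R is the graph of a permutation. *)
Theorem adapted_invariant h R F G : adapted h -> invariant R ->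
  F \in I2 2 -> G \in I2 2 -> agree R F G -> R (h F) (h G).
Proof.
move=> hh iR FI GI FG; have [hsub hsec haut] := hh; have [lF lG FGw] := FG.
have [Rb _ _] := iR.
have hF : h F \in dom R.
  apply: hsub lF => // x y; rewrite !inE => /existsP[x' xx'] /existsP[y' yy'].
  by apply/existsP; exists (b x' y'); apply: Rb.
have hG : h G \in ran R.
  apply: hsub lG => // x y; rewrite !inE => /existsP[x' xx'] /existsP[y' yy'].
  by apply/existsP; exists (b x' y'); apply: Rb.
move: (hF) (hG); rewrite !inE => /existsP[y' xy'] /existsP[x' x'y].
move E1: (h F) xy' => x xy'; move E2: (h G) x'y => y x'y.
case: (boolP (R x y)) => // nxy; exfalso.
have rect := rectangular iR.
pose P := [set a | R a y']; pose Q := [set a | R a y].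
pose P' := [set c | R x c]; pose Q' := [set c | R x' c].
have xP : x \in P by rewrite inE.
have x'Q : x' \in Q by rewrite inE.
have y'P' : y' \in P' by rewrite inE.
have yQ' : y \in Q' by rewrite inE.
have dPQ : [disjoint P & Q].
  apply/pred0P=> a; apply/negP; rewrite /= !inE => /andP[ay' ay].
  by case/negP: nxy; apply: rect xy' ay' ay.
have dPQ' : [disjoint P' & Q'].
  apply/pred0P=> a; apply/negP; rewrite /= !inE => /andP[ay' ay].
  by case/negP: nxy; apply: rect ay' ay x'y.
have row a c : R a c -> (a \in P) = (c \in P') /\ (a \in Q) = (c \in Q').
  rewrite !inE => ac; split; apply/idP/idP => h1.
  - exact: rect xy' h1 ac.
  - exact: rect ac h1 xy'.
  - exact: rect x'y h1 ac.
  - exact: rect ac h1 x'y.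
case: (boolP (dom R \subset P :|: Q)) => [/subsetP domPQ|].
  have RE a c : R a c = (a \in P) && (c \in P') || (a \in Q) && (c \in Q').
    apply/idP/orP => [ac|[]/andP[]].
    - have [<- <-] := row _ _ ac; rewrite !andbb; apply/orP; rewrite -in_setU.
      by apply: domPQ; rewrite inE; apply/existsP; exists c.
    - by rewrite !inE => ay' xc; apply: rect ay' xy' xc.
    - by rewrite !inE => ay x'c; apply: rect ay x'y x'c.
  have : b x x' \in P :|: Q.
    by apply: domPQ; rewrite inE; apply/existsP; exists (b y' y); apply: Rb.
  rewrite inE => /orP[] bx.
  - have := adapted_blocks hh iR FI GI FG RE dPQ dPQ' xP x'Q y'P' yQ' bx.
    by rewrite E1 E2 yQ' (disjointFr dPQ xP).
  - rewrite bC in bx; rewrite disjoint_sym in dPQ; rewrite disjoint_sym in dPQ'.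
    have RE' a c : R a c = (a \in Q) && (c \in Q') || (a \in P) && (c \in P').
      by rewrite RE orbC.
    have := adapted_blocks hh iR FI GI FG RE' dPQ dPQ' x'Q xP yQ' y'P' bx.
    by rewrite E1 E2 xP (disjointFr dPQ' yQ').
case/subsetPn=> z; rewrite inE => /existsP[z' zz']; rewrite inE negb_or => /andP[zP zQ].
have [zP' zQ'] := row _ _ zz'; rewrite (negbTE zP) in zP'; rewrite (negbTE zQ) in zQ'.
have xx' : x != x' by apply: contraTneq x'Q => <-; rewrite (disjointFr dPQ xP).
have yy' : y' != y by apply: contraTneq yQ' => <-; rewrite (disjointFr dPQ' y'P').
have zx : z != x by apply: contraNneq zP => ->.
have zx' : z != x' by apply: contraNneq zQ => ->.
have zy : z' != y by apply: contraTneq yQ' => <-; rewrite -zQ'.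
have zy' : z' != y' by apply: contraTneq y'P' => <-; rewrite -zP'.
have covx a : [\/ a = x, a = x' | a = z].
  have [c [_ _ cov]] := third_element xx'.
  case: (cov z) => e; [by rewrite e eqxx in zx|by rewrite e eqxx in zx'|].
  by rewrite e.
have covy a : [\/ a = y', a = y | a = z'].
  have [c [_ _ cov]] := third_element yy'.
  case: (cov z') => e; [by rewrite e eqxx in zy'|by rewrite e eqxx in zy|].
  by rewrite e.
pose sigma a := if a == x then y' else if a == x' then y else z'.
have E := (negbTE zx, negbTE zx', negbTE zy, negbTE zy', negbTE yy', negbTE nxy).
have E' : ((x' == x) = false) * ((y == y') = false) *
    ((y == z') = false) * ((y' == z') = false).
  by rewrite -!(eq_sym x) -!(eq_sym z') (eq_sym y) !E (negbTE xx').
have RE a c : R a c = (c == sigma a).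
  rewrite /sigma; case: (covx a) => ->; rewrite ?E' ?eqxx ?E; case: (covy c) => ->;
  rewrite ?E' ?eqxx ?E ?xy' ?x'y ?zz' //; apply/negbTE/negP=> /row;
  rewrite -?zP' -?zQ' ?(negbTE zP) ?(negbTE zQ) ?xP ?x'Q ?y'P' ?yQ'
    ?(disjointFr dPQ xP) ?(disjointFl dPQ x'Q) ?(disjointFr dPQ' y'P') ?(disjointFl dPQ' yQ');
  by case.
have sigma_inj : injective sigma.
  move=> a a'; rewrite /sigma; case: (covx a) => ->; case: (covx a') => ->;
  rewrite ?E' ?eqxx ?E // => /eqP; by rewrite ?E' ?E.
have := haut sigma R F G FI GI sigma_inj RE iR FG.
by rewrite E1 E2 /sigma eqxx => e; rewrite e eqxx in yy'.
Qed.

Lemma eq_invariant R T : R =2 T -> invariant R -> invariant T.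
Proof.
move=> e [Rb Rp Rs]; split.
- by move=> x x' y y'; rewrite -!e; apply: Rb.
- by move=> x x' y y' z z'; rewrite -!e; apply: Rp.
- by move=> x x' y y' z z'; rewrite -!e; apply: Rs.
Qed.

(** * The case of a nontrivial congruence *)

Definition isolates (w : E3) : rel E3 := fun x y => (x == w) == (y == w).

(** Distinct nontrivial congruences on three elements do not permute.  Composing
    the congruence isolating w with K relates every element to w; by rectangularity
    the composite also relates w to every element, and since w is alone in its class,
    K does so. *)
Lemma invariant_isolates_full w K : invariant (isolates w) -> invariant K -> reflexive K ->
  forall z, z != w -> K w z -> forall z', K w z'.
Proof.
move=> iw iK rK z zw wz z'; case: (eqVneq z' w) => [->|z'w]; first exact: rK.
have zK : K z w by apply: (rectangular iK (rK z) wz); apply: rK.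
have T1 : compose_rel (isolates w) K z' w.
  by apply/compose_relP; exists z; rewrite // /isolates (negbTE zw) (negbTE z'w).
have Tr x : compose_rel (isolates w) K x x.
  by apply/compose_relP; exists x; rewrite // /isolates eqxx.
have /compose_relP[a] := rectangular (invariant_compose iw iK) (Tr w) T1 (Tr z').
by rewrite /isolates eqxx => /eqP/esym/eqP ->.
Qed.

Section Isolated.
Variables u v w : E3.
Hypotheses (uv : u != v) (uw : u != w) (vw : v != w).
Hypothesis cov : forall x, [\/ x = u, x = v | x = w].
Hypothesis iw : invariant (isolates w).
Hypotheses (buv : b u v = u) (bw : forall x, x != w -> b x w != w).

(** For the order u < v < w, w is elected if the upper set {w} wins, and v if only
    the larger upper set {v, w} does.  Testing {w} first, so that w and the lower
    elements are told apart by {w} alone, is what respects the congruence. *)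
Definition chain_vote (F : op 'I_2 2) :=
  if wins F [set w] then w else if wins F [set v; w] then v else u.

(** The upper block Q of a two-element quotient is cut out of its union with P by an
    upper set of the order: {w} for the congruence and for pairs containing w,
    {v, w} for the pair {u, v}.  An automorphism fixes w, because it preserves the
    only nontrivial congruence, and cannot exchange u and v, because b(u,v) = u. *)
Lemma chain_vote_adapted : adapted chain_vote.
Proof.
have [vu wu wv] : [/\ v != u, w != u & w != v] by rewrite !(eq_sym _ u) (eq_sym w).
split.
- move=> F B FI _ lF; rewrite /chain_vote; apply: contraT.
  case: ifPn => [wi|nw].
    move=> wB; rewrite (lives_lose FI lF) in wi => //.
    by rewrite disjoints1.
  case: ifPn => [vi|nv] => nB.
    move: vi; rewrite (livesP _ _ lF _ [set w]) ?(negbTE nw) // => x xB.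
    by rewrite !inE; case: eqP => // xv; rewrite -xv xB in nB.
  move: nv; rewrite (livesP _ _ lF _ setT) ?wins_setT // => x xB.
  rewrite !inE; case: (cov x) => e; rewrite e ?eqxx ?orbT //.
  by rewrite -e xB in nB.
- move=> F P Q K FI dPQ /set0Pn[p0 p0P] /set0Pn[q0 q0Q] iK KE bPQ lF.
  have nQ x : x \in P -> x \in Q = false by apply: disjointFr.
  have nP x : x \in Q -> x \in P = false by apply: disjointFl.
  have Kxx x : K x x = (x \in P) || (x \in Q) by rewrite KE /blocks !andbb.
  have all_w z t : z != w -> K w z -> (t \in P) || (t \in Q) -> K w t.
    move=> zw wz tPQ.
    have wPQ : K w w by rewrite Kxx; move: wz; rewrite KE => /orP[] /andP[-> _]; rewrite ?orbT.
    have zPQ : K z z by rewrite Kxx; move: wz; rewrite KE => /orP[] /andP[_ ->]; rewrite ?orbT.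
    case: (eqVneq t z) => [-> //|tz]; case: (eqVneq t w) => [-> //|tw].
    apply: (invariant_isolates_full iw iK _ zw wz) => x.
    have [c [_ _ cov']] := third_element tz.
    case: (cov' w) => e; [by rewrite e eqxx in tw|by rewrite e eqxx in zw|].
    by case: (cov' x) => ->; [rewrite Kxx|exact: zPQ|rewrite -e].
  have wP : w \notin P.
    apply/negP=> wP; have q0w : q0 != w by apply: contraTneq q0Q => ->; rewrite nQ.
    have bP := bPQ _ _ wP q0Q.
    have bw0 : b w q0 != w by rewrite bC; apply: bw.
    have := all_w _ q0 bw0; rewrite !KE /blocks wP bP q0Q (nQ _ wP) (nP _ q0Q) orbT /=.
    by move/(_ isT isT).
  case: (boolP (w \in Q)) => wQ.
    have QE x : (x \in Q) = (x == w).
      apply/idP/eqP => [xQ|-> //]; apply/eqP; apply: contraT => xw.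
      have := all_w _ p0 xw; rewrite !KE /blocks wQ xQ p0P (negbTE wP) (nQ _ p0P) /=.
      by move/(_ isT isT).
    have -> : Q = [set w] by apply/setP=> x; rewrite QE inE.
    rewrite inE /chain_vote; case: (wins F [set w]); first by rewrite eqxx.
    by case: (wins _ _); apply/negbTE.
  have nw : wins F [set w] = false.
    by apply: (lives_lose FI lF); rewrite disjoints1 inE negb_or wP.
  have uP : u \in P.
    case: (cov p0) p0P => ->; [by []| move=> vP|by rewrite (negbTE wP)].
    have uQ : u \in Q.
      case: (cov q0) q0Q => -> //; last by rewrite (negbTE wQ).
      by rewrite (nQ _ vP).
    by have := bPQ _ _ vP uQ; rewrite bC buv nP.
  have vQ : v \in Q.
    by case: (cov q0) q0Q => -> //; [rewrite (nQ _ uP)|rewrite (negbTE wQ)].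
  have -> : wins F Q = wins F [set v; w].
    apply: (livesP _ _ lF) => x; rewrite !inE; case: (cov x) => ->.
    - by rewrite (nQ _ uP) (negbTE uv) (negbTE uw).
    - by rewrite vQ eqxx.
    - by rewrite (negbTE wP) (negbTE wQ).
  by rewrite /chain_vote nw; case: (wins _ _); rewrite ?vQ // nQ.
- move=> sigma R F G FI GI sI RE iR [_ _ FG].
  have sw : sigma w = w.
    (* The preimage of the congruence under sigma. *)
    pose K := compose_rel R (compose_rel (isolates w) (inverse_rel R)).
    have KE x y : K x y = ((sigma x == w) == (sigma y == w)).
      apply/compose_relP/idP => [[z]|h].
        rewrite RE => /eqP-> /compose_relP[t h]; rewrite /inverse_rel RE => /eqP e.
        by move: h; rewrite e.
      exists (sigma x); first by rewrite RE.
      by apply/compose_relP; exists (sigma y); rewrite // /inverse_rel RE.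
    have iK : invariant K.
      by do 2?apply: invariant_compose => //; apply: invariant_inverse.
    have rK : reflexive K by move=> x; rewrite KE eqxx.
    apply/eqP; apply: contraT => sw.
    have [z zw sz] : exists2 z, z != w & sigma z != w.
      case: (eqVneq (sigma u) w) => su; last by exists u.
      by exists v => //; rewrite -su (inj_eq sI).
    have allw := invariant_isolates_full iw iK rK zw; rewrite KE (negbTE sw) (negbTE sz) in allw.
    have [g _ sg] := injF_bij sI.
    by have := allw isT (g w); rewrite KE sg (negbTE sw) eqxx.
  have sid : sigma =1 id.
    have su : sigma u != w by rewrite -sw (inj_eq sI).
    have sv : sigma v != w by rewrite -sw (inj_eq sI).
    have suE : sigma u = u.
      case: (cov (sigma u)) => e //; last by rewrite e eqxx in su.
      have e' : sigma v = u.
        case: (cov (sigma v)) => // e'; last by rewrite e' eqxx in sv.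
        by move: uv; rewrite -(inj_eq sI) e e' eqxx.
      have [Rb _ _] := iR.
      have := Rb u v v u; rewrite !RE e e' !eqxx buv bC buv e => /(_ isT isT)/eqP e''.
      by have := uv; rewrite e'' eqxx.
    have svE : sigma v = v.
      case: (cov (sigma v)) => e //; last by rewrite e eqxx in sv.
      by move: uv; rewrite -(inj_eq sI) suE e eqxx.
    by move=> x; case: (cov x) => ->.
  have FGw Q : wins F Q = wins G Q by apply: FG => x y; rewrite RE => /eqP->; rewrite sid.
  by rewrite sid /chain_vote !FGw.
Qed.
End Isolated.

(** * The case without nontrivial congruences *)

Section NoCongruence.
Hypothesis no_isolated : forall w, ~ invariant (isolates w).
Hypothesis sC12 : forall x y z, s x y z = s y x z.
Hypothesis sC23 : forall x y z, s x y z = s x z y.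

Definition oriented_pair (F : op 'I_2 2) (ij : E3 * E3) :=
  [&& ij.1 != ij.2, b ij.1 ij.2 == ij.1 & lives F [set ij.1; ij.2]].

(** Elections decided by one element or by two elements oriented by b have a forced
    outcome; in all other cases only compatibility with automorphisms matters. *)
Definition pair_vote (F : op 'I_2 2) : E3 :=
  if [pick k | lives F [set k]] is Some k then k else
  if [pick ij | oriented_pair F ij] is Some ij
  then if wins F [set ij.2] then ij.2 else ij.1 else s t0 t1 t2.

Lemma lives_set1_eq F i j : F \in I2 2 -> lives F [set i] -> lives F [set j] -> i = j.
Proof.
move=> FI li lj; have := livesI li lj; case: (eqVneq i j) => // ij.
rewrite (_ : _ :&: _ = set0) ?(lives_set0 FI) //.
by apply/setP=> x; rewrite !inE; case: eqP => // ->; rewrite (negbTE ij).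
Qed.

Lemma pair_vote_dictator F k : F \in I2 2 -> lives F [set k] -> pair_vote F = k.
Proof.
move=> FI lk; rewrite /pair_vote; case: pickP => [k' lk'|/(_ k)]; last by rewrite lk.
exact: lives_set1_eq lk.
Qed.

(** The oriented pair found by the definition may differ from (i, j).  If the two
    pairs have one element or none in common, the election is decided by that
    element alone, or by nobody; and (j, i) is not oriented along with (i, j),
    because b is commutative. *)
Lemma pair_vote_pair F i j : F \in I2 2 -> oriented_pair F (i, j) ->
  pair_vote F = if wins F [set j] then j else i.
Proof.
move=> FI ij; have /and3P[/= ne /eqP bij lij] := ij.
rewrite /pair_vote; case: pickP => [k lk|no1].
  have : k \in [set i; j].
    apply: contraT => kij; have := lives_wins FI lk.
    by rewrite (lives_lose FI lij) // disjoints1.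
  rewrite !inE => /orP[] /eqP e; subst k.
    by rewrite (lives_lose FI lk) // disjoints1 inE eq_sym.
  by rewrite (lives_wins FI lk).
case: pickP => [[i' j'] ij'|/(_ (i, j))]; last by rewrite ij.
have /and3P[/= ne' /eqP bij' lij'] := ij'.
have single k : [set i; j] :&: [set i'; j'] \subset [set k] -> False.
  by move=> /lives_sub/(_ (livesI lij lij')); rewrite no1.
case: (eqVneq i i') => [ii'|ii']; case: (eqVneq j j') => [jj'|jj']; first by rewrite ii' jj'.
- case: (single i); apply/subsetP=> x; rewrite !inE -ii' => /andP[/orP[]/eqP-> //].
  by rewrite (negbTE jj') orbF.
- case: (single j); apply/subsetP=> x; rewrite !inE -jj' => /andP[/orP[]/eqP-> //].
  by rewrite (negbTE ii') orFb.
case: (eqVneq i j') => [ij''|ij''].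
  case: (eqVneq j i') => [ji|ji].
    by move: ne; rewrite -bij bC ij'' ji bij' eqxx.
  case: (single i); apply/subsetP=> x; rewrite !inE => /andP[/orP[]/eqP-> //].
  by rewrite (negbTE ji) (negbTE jj').
case: (single j); apply/subsetP=> x; rewrite !inE => /andP[/orP[]/eqP-> //].
by rewrite (negbTE ii') (negbTE ij'').
Qed.

Lemma pair_vote_default F : (forall k, ~~ lives F [set k]) -> (forall ij, ~~ oriented_pair F ij) ->
  pair_vote F = s t0 t1 t2.
Proof.
move=> no1 no2; rewrite /pair_vote; case: pickP => [k|_]; first by rewrite (negbTE (no1 k)).
by case: pickP => // ij; rewrite (negbTE (no2 ij)).
Qed.

Lemma symmetric_fixed (sigma : E3 -> E3) : injective sigma ->
  s (sigma t0) (sigma t1) (sigma t2) = s t0 t1 t2.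
Proof.
move=> sI.
have ord3 (x : E3) : [\/ x = t0, x = t1 | x = t2].
  by case: x => [[|[|[|//]]] i]; [apply: Or31|apply: Or32|apply: Or33]; apply: val_inj.
have ne01 : sigma t0 != sigma t1 by rewrite (inj_eq sI).
have ne02 : sigma t0 != sigma t2 by rewrite (inj_eq sI).
have ne12 : sigma t1 != sigma t2 by rewrite (inj_eq sI).
move: ne01 ne02 ne12; case: (ord3 (sigma t0)) => ->; case: (ord3 (sigma t1)) => -> //;
  case: (ord3 (sigma t2)) => -> // _ _ _.
all: by rewrite ?(sC12 t1 t0) ?(sC12 t2 t0) ?(sC12 t2 t1)
  ?(sC23 _ t2 t1) ?(sC23 _ t2 t0) ?(sC23 _ t1 t0)
  ?(sC12 t1 t0) ?(sC12 t2 t0) ?(sC12 t2 t1) ?(sC23 _ t2 t1).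
Qed.

(** A two-element quotient whose blocks P and Q cover all three elements would be a
    congruence, so P and Q are singletons and the outcome is the one forced by b.
    An automorphism commutes with b, hence maps oriented pairs to oriented pairs,
    and fixes the default value by symmetry of s. *)
Lemma pair_vote_adapted : adapted pair_vote.
Proof.
split.
- move=> F B FI bB lF.
  have /set0Pn[k kB] : B != set0 by apply: contraTneq lF => ->; rewrite lives_set0.
  case: (boolP (B \subset [set k])) => [Bk|/subsetPn[k' k'B]].
    by rewrite (pair_vote_dictator FI (lives_sub Bk lF)).
  rewrite inE => k'k.
  have [c [_ _ cov]] := third_element k'k.
  case: (boolP (c \in B)) => cB; first by case: (cov (pair_vote F)) => ->.
  have BE : B \subset [set k; k'].
    by apply/subsetP=> x xB; rewrite !inE; case: (cov x) xB => ->;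
      rewrite ?eqxx ?orbT // (negbTE cB).
  have lkk' := lives_sub BE lF.
  have : b k k' \in B by apply: bB.
  case: (cov (b k k')) => e; rewrite e ?(negbTE cB) // => _.
    have op : oriented_pair F (k', k) by rewrite /oriented_pair /= k'k bC e eqxx setUC lkk'.
    by rewrite (pair_vote_pair FI op); case: ifP.
  have op : oriented_pair F (k, k') by rewrite /oriented_pair /= eq_sym k'k e eqxx lkk'.
  by rewrite (pair_vote_pair FI op); case: ifP.
- move=> F P Q K FI dPQ /set0Pn[i iP] /set0Pn[j jQ] iK KE bPQ lF.
  have nQ x : x \in P -> x \in Q = false by apply: disjointFr.
  have nP x : x \in Q -> x \in P = false by apply: disjointFl.
  have ij : i != j by apply: contraTneq jQ => <-; rewrite nQ.
  have [c [ci cj cov]] := third_element ij.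
  have cP : c \notin P.
    apply/negP=> cP; case: (no_isolated (w := j)); apply: eq_invariant iK => x y.
    rewrite KE /blocks /isolates; case: (cov x) => ->; case: (cov y) => ->;
    by rewrite ?iP ?cP ?jQ ?(nQ _ iP) ?(nQ _ cP) ?(nP _ jQ) ?(negbTE ij) ?(negbTE cj) ?eqxx.
  have cQ : c \notin Q.
    apply/negP=> cQ; case: (no_isolated (w := i)); apply: eq_invariant iK => x y.
    have ji : j != i by rewrite eq_sym.
    rewrite KE /blocks /isolates; case: (cov x) => ->; case: (cov y) => ->;
    by rewrite ?iP ?cQ ?jQ ?(nQ _ iP) ?(nP _ cQ) ?(nP _ jQ) ?(negbTE ji) ?(negbTE ci) ?eqxx.
  have PE : P = [set i].
    apply/setP=> x; rewrite inE; case: (cov x) => ->; rewrite ?iP ?eqxx //.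
      by rewrite (nP _ jQ) eq_sym (negbTE ij).
    by rewrite (negbTE cP) (negbTE ci).
  have QE : Q = [set j].
    apply/setP=> x; rewrite inE; case: (cov x) => ->; rewrite ?jQ ?eqxx //.
      by rewrite (nQ _ iP) (negbTE ij).
    by rewrite (negbTE cQ) (negbTE cj).
  have op : oriented_pair F (i, j).
    have := bPQ _ _ iP jQ; rewrite PE inE => bij.
    by rewrite /oriented_pair /= ij bij -PE -QE.
  rewrite (pair_vote_pair FI op) QE inE; case: (wins _ _); first by rewrite eqxx.
  exact/negbTE.
- move=> sigma R F G FI GI sI RE iR [_ _ FG].
  have [g sg gs] := injF_bij sI.
  have wE (Q : {set E3}) : wins G (sigma @: Q) = wins F Q.
    by apply/esym/FG => x y; rewrite RE => /eqP->; rewrite mem_imset.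
  have lE (B : {set E3}) : lives G (sigma @: B) = lives F B.
    apply/forallP/forallP => h Q.
      have := h (sigma @: Q); rewrite -imsetI ?wE //; last by move=> x y _ _; apply: sI.
    have -> : Q = sigma @: (g @: Q).
      by rewrite -imset_comp -[LHS]imset_id; apply: eq_imset => x /=; rewrite gs.
    by rewrite -imsetI ?wE //; move=> x y _ _; apply: sI.
  have lE1 k : lives G [set sigma k] = lives F [set k] by rewrite -imset_set1 lE.
  have [Rb _ Rs] := iR.
  have bE x y : b (sigma x) (sigma y) = sigma (b x y).
    by have := Rb x (sigma x) y (sigma y); rewrite !RE !eqxx => /(_ isT isT)/eqP.
  have oE i j : oriented_pair G (sigma i, sigma j) = oriented_pair F (i, j).
    by rewrite /oriented_pair /= bE !(inj_eq sI) -lE imsetU !imset_set1.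
  case: (pickP (fun k => lives F [set k])) => [k lk|no1].
    by rewrite (pair_vote_dictator FI lk) (pair_vote_dictator GI (k := sigma k)) ?lE1.
  case: (pickP (oriented_pair F)) => [[i j] op|no2].
    rewrite (pair_vote_pair FI op) (pair_vote_pair GI (i := sigma i) (j := sigma j)) ?oE //.
    by rewrite -imset_set1 wE; case: ifP.
  rewrite (@pair_vote_default F) => [|k|ij]; [|by rewrite no1|by rewrite no2].
  rewrite (@pair_vote_default G) => [|k|[i j]]; last first.
  - by rewrite -(gs i) -(gs j) oE no2.
  - by rewrite -(gs k) lE1 no1.
  have := Rs t0 (sigma t0) t1 (sigma t1) t2 (sigma t2).
  by rewrite !RE !eqxx => /(_ isT isT isT)/eqP <-; rewrite symmetric_fixed.
Qed.
End NoCongruence.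

End Invariant.

(** * Selecting the election rule *)

Section Selection.
Variables (b : E3 -> E3 -> E3) (p s : E3 -> E3 -> E3 -> E3).
Hypotheses (mp : maltsev p) (bC : forall x y, b x y = b y x) (bxx : forall x, b x x = x).

Definition invariantb (R : rel E3) :=
  [&& [forall u : E3 * E3, forall v : E3 * E3,
         R u.1 u.2 ==> R v.1 v.2 ==> R (b u.1 v.1) (b u.2 v.2)],
      [forall u : E3 * E3, forall v : E3 * E3, forall w : E3 * E3,
         R u.1 u.2 ==> R v.1 v.2 ==> R w.1 w.2 ==> R (p u.1 v.1 w.1) (p u.2 v.2 w.2)] &
      [forall u : E3 * E3, forall v : E3 * E3, forall w : E3 * E3,
         R u.1 u.2 ==> R v.1 v.2 ==> R w.1 w.2 ==> R (s u.1 v.1 w.1) (s u.2 v.2 w.2)]].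

Lemma invariantP R : reflect (invariant b p s R) (invariantb R).
Proof.
apply: (iffP and3P) => -[Rb Rp Rs]; split.
- move=> x x' y y' xx yy; move/forallP/(_ (x, x'))/forallP/(_ (y, y')): Rb.
  by rewrite xx yy.
- move=> x x' y y' z z' xx yy zz.
  move/forallP/(_ (x, x'))/forallP/(_ (y, y'))/forallP/(_ (z, z')): Rp.
  by rewrite xx yy zz.
- move=> x x' y y' z z' xx yy zz.
  move/forallP/(_ (x, x'))/forallP/(_ (y, y'))/forallP/(_ (z, z')): Rs.
  by rewrite xx yy zz.
- by apply/forallP=> u; apply/forallP=> v; apply/implyP=> ?; apply/implyP=> ?; apply: Rb.
- by apply/forallP=> u; apply/forallP=> v; apply/forallP=> w;
    do 3?[apply/implyP=> ?]; apply: Rp.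
- by apply/forallP=> u; apply/forallP=> v; apply/forallP=> w;
    do 3?[apply/implyP=> ?]; apply: Rs.
Qed.

(** On a two-element quotient where b is one semilattice operation, p(x, b(x,y), y)
    is the opposite one; the outer b restores commutativity elsewhere. *)
Definition join x y := b (p x (b x y) y) (p y (b y x) x).

Lemma exists_adapted_isolated w : invariant b p s (isolates w) ->
  (forall x, x != w -> b x w != w) -> exists h, adapted b p s h.
Proof.
move=> iw bw.
have [u uw] : exists u, u != w.
  by case: (eqVneq t0 w) => [<-|]; [exists t1|exists t0].
have [v [vu vw cov]] := third_element uw.
have [iwb _ _] := iw.
have : b u v != w.
  by have := iwb u u u v; rewrite /isolates bxx (negbTE uw) (negbTE vw) => /(_ isT isT)/eqP <-.
case: (cov (b u v)) => e; rewrite e ?eqxx // => _.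
  exists (chain_vote u v w); apply: chain_vote_adapted => //.
  - by rewrite eq_sym.
  - by move=> x; case: (cov x) => ->; [apply: Or31|apply: Or33|apply: Or32].
exists (chain_vote v u w); apply: chain_vote_adapted => //.
- by move=> x; case: (cov x) => ->; [apply: Or32|apply: Or33|apply: Or31].
- by rewrite bC.
Qed.
End Selection.

(** When b has w as the lower element of the quotient by the congruence, [join]
    reverses the orientation, so that w can always be the top of the chain. *)
Lemma exists_adapted b p s (C : opset E3) : clone C ->
  definable2 C b -> definable3 C p -> maltsev p ->
  (forall x y, b x y = b y x) -> (forall x, b x x = x) ->
  (forall x y z, s x y z = s y x z) -> (forall x y z, s x y z = s x z y) ->
  exists b', [/\ definable2 C b', forall x y, b' x y = b' y x &
    exists h, adapted b' p s h].
Proof.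
move=> hC db dp mp bC bxx s12 s23.
case: (pickP (fun w => invariantb b p s (isolates w))) => [w /invariantP iw|no]; last first.
  exists b; split=> //; exists (pair_vote b s); apply: pair_vote_adapted => //.
  by move=> w /invariantP; rewrite no.
case: (pickP (fun x => (x != w) && (b x w == w))) => [x0 /andP[x0w /eqP bx0]|no]; last first.
  exists b; split=> //; apply: (@exists_adapted_isolated _ _ _ _ _ _ w) => // x xw.
  by have := no x; rewrite /= xw /= => /negbT.
have [iwb iwp iws] := iw.
have bx x : b x w = w.
  case: (eqVneq x w) => [-> //|xw].
  have := iwb x0 x w w; rewrite /isolates (negbTE x0w) (negbTE xw) bx0 !eqxx.
  by move=> /(_ isT isT)/eqP/esym/eqP.
have jC x y : join b p x y = join b p y x by rewrite /join bC.
exists (join b p); split=> //.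
  have dm (i j : 'I_2) : definable C (fun v : {ffun 'I_2 -> E3} => p (v i) (b (v i) (v j)) (v j)).
    apply: (definable_comp3 hC dp); try exact: definable_var.
    by apply: (definable_comp2 hC db); apply: definable_var.
  by apply: (definable_comp2 hC db).
apply: (@exists_adapted_isolated _ _ _ _ _ _ w) => //.
- by move=> x; rewrite /join !bxx mp.1.
- split=> // x x' y y' xx yy.
  by apply: (iwb); apply: iwp => //; apply: iwb.
- by move=> x xw; rewrite /join (bC w) bx mp.1 mp.2 bxx.
Qed.

(** * The minor homomorphism *)

Lemma I2_minor n r (t : 'I_n.+1 -> 'I_r.+1) f : f \in I2 n -> minor t f \in I2 r.
Proof.
rewrite !inE /= !preserves1P => /and3P[/eqP f0 /eqP f1 _].
rewrite !ffunE andbT; apply/andP; split; apply/eqP; [rewrite -[RHS]f0|rewrite -[RHS]f1];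
  by congr (f _); apply/ffunP=> i; rewrite !ffunE.
Qed.

Theorem corollary3p13 (S : opset 'I_3) (hS : clone S)
    (hidem : idempotent_opset S)
    (hC2 : ~ minor_le S C2) (hC3 : ~ minor_le S C3) (hB2 : ~ minor_le S B2) :
  minor_le I2 S.
Proof.
have [b db bC] := commutative_of_not_C2 hS hC2.
have [c dc cC] := cyclic_of_not_C3 hS hC3.
have [q dq mq] : exists2 q, definable3 S q & maltsev q.
  by apply: maltsev_of_not_B2 => //; exists t0, t1.
have [m dm maj] := exists_majority hS hidem db dc dq bC cC mq.
pose s x y z := b (c x y z) (c y x z).
have ds : definable3 S s.
  by apply: (definable_comp2 hS db); apply: (definable_comp3 hS dc); apply: definable_var.
have s12 x y z : s x y z = s y x z by rewrite /s bC.
have s23 x y z : s x y z = s x z y by rewrite /s bC (cC x z y) (cC z y x) (cC z x y).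
have [b' [db' bC' [h hh]]] := exists_adapted hS db dq mq bC (definable2_idem hidem db) s12 s23.
apply: (induced_minor_le (kappa := h)) => n f fI.
apply: (baker_pixley hS dm maj) => x y.
(* The subalgebra of the square generated by the pairs (x i, y i). *)
pose R : rel E3 := fun u v => [exists g : op E3 n, [&& g \in S n, g x == u & g y == v]].
have RP u v : reflect (exists g, [/\ definable S g, g x = u & g y = v]) (R u v).
  apply: (iffP existsP) => [[g /and3P[gS /eqP gx /eqP gy]]|[g [gS gx gy]]].
    by exists g; split=> //; apply: (definable_op gS).
  by exists (finfun g); apply/and3P; split; rewrite ?ffunE ?gx ?gy.
have iR : invariant b' q s R.
  split.
  - move=> ? ? ? ? /RP[g1 [d1 <- <-]] /RP[g2 [d2 <- <-]]; apply/RP.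
    by exists (fun v => b' (g1 v) (g2 v)); split=> //; apply: definable_comp2.
  - move=> ? ? ? ? ? ? /RP[g1 [d1 <- <-]] /RP[g2 [d2 <- <-]] /RP[g3 [d3 <- <-]]; apply/RP.
    by exists (fun v => q (g1 v) (g2 v) (g3 v)); split=> //; apply: definable_comp3.
  - move=> ? ? ? ? ? ? /RP[g1 [d1 <- <-]] /RP[g2 [d2 <- <-]] /RP[g3 [d3 <- <-]]; apply/RP.
    by exists (fun v => s (g1 v) (g2 v) (g3 v)); split=> //; apply: definable_comp3.
have /RP[g [dg gx gy]] : R (induced h f x) (induced h f y).
  rewrite !ffunE; apply: (adapted_invariant mq bC' hh iR); rewrite ?I2_minor //.
  by apply: agree_minor => i; apply/RP; exists (fun v => v i); split=> //; apply: definable_var.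
by exists (finfun g); split; rewrite // [LHS]ffunE.
Qed.
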